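(* Under the action of $\mathrm{GL}(3,\mathbb R)$, the operators $L(V)$ and $Q(dV)$ transform as elements of $\ell^6$; that is, regarding $L$ as a map $$L\colon S^2(U)\times R\times\ell^{-6}S^2(U)\to S^2(U),\qquad L(V,V^{(2)},V_{\mu\mu})_{ij}=(V_{\mu\mu})_{ij}+\sum_{k,l}V_{kl}V_{ij,kl},$$ and $Q$ as the quadratic map $$Q\colon \ell^{-4}\Gamma_{2,1}\to S^2(U),\qquad Q(V^{(1)})_{ij}=-\sum_{a,b=1}^3V_{ia,b}V_{jb,a},$$ each of $L$ and $Q$ spans a one-dimensional $\mathrm{GL}(3,\mathbb R)$-module isomorphic to $\ell^6$, under the induced action $(A\cdot F)(x)=A\cdot F(A^{-1}\cdot x)$ on maps. Moreover, up to scaling, $Q$ is the unique $S^2(U)$-valued quadratic form in $dV=V^{(1)}\in\ell^{-4}\Gamma_{2,1}$ with this property.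
   Context: $\mathrm{GL}(3,\mathbb R)\cong\mathbb R^\times\times\mathrm{SL}(3,\mathbb R)$ (scalar matrices times $\mathrm{SL}(3,\mathbb R)$). Irreducible representations are written $\ell^p\Gamma_{a,b}$, where $\Gamma_{a,b}$ is an irreducible representation of $\mathrm{SL}(3,\mathbb R)$ and $\ell$ is the standard one-dimensional representation $t\mapsto t$ of $\mathbb R^\times$; thus $\ell^6$ is the character $A\mapsto\det(A)^2$. The standard representation is $\mathbb R^3=\ell^1\Gamma_{0,1}$, and $U=(\mathbb R^3)^*=\ell^{-1}\Gamma_{1,0}$. The setting: $V=(V_{ij})$ is a function of $(\nu_1,\nu_2,\nu_3,\mu)$ valued in symmetric $3\times3$ matrices and satisfying $\sum_i\partial V_{ij}/\partial\nu_i=0$ for $j=1,2,3$, and the differential operators considered are $$L=\frac{\partial^2}{\partial\mu^2}+\sum_{i,j}V_{ij}\frac{\partial^2}{\partial\nu_i\partial\nu_j},\qquad Q(dV)_{ij}=-\sum_{a,b=1}^3\frac{\partial V_{ia}}{\partial\nu_b}\frac{\partial V_{jb}}{\partial\nu_a}.$$ $\mathrm{GL}(3,\mathbb R)$ acts by change of basis of the Lie algebra of $T^3$; under it $V\in S^2(U)=\ell^{-2}\Gamma_{2,0}$, $\partial/\partial\nu=(\partial/\partial\nu_k)$ transforms as $\ell^{-3}U^*$ and $\partial/\partial\mu$ as $\ell^{-3}$ (explicitly $A$ acts by $V\mapsto A^{-t}VA^{-1}$, $\nu\mapsto\det(A)A^{-t}\nu$, $\mu\mapsto\det(A)\mu$).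 The first derivatives $V^{(1)}=(V_{ij,k})=(\partial V_{ij}/\partial\nu_k)$ lie in $S^2(U)\otimes\ell^{-3}U^*=\ell^{-4}\Gamma_{1,0}\oplus\ell^{-4}\Gamma_{2,1}$, where the projection to $\ell^{-4}\Gamma_{1,0}$ is the contraction $\sum_iV_{ij,i}$ and $\ell^{-4}\Gamma_{2,1}$ is its kernel; the divergence-free condition says $V^{(1)}\in\ell^{-4}\Gamma_{2,1}$. The second derivatives $V^{(2)}=(V_{ij,kl})=(\partial^2V_{ij}/\partial\nu_k\partial\nu_l)$ lie in $R=(S^2(U)\otimes S^2(\ell^{-3}U^* ))\cap(\ell^{-6}\Gamma_{2,1}\otimes\Gamma_{0,1})$, i.e. satisfy $\sum_iV_{ij,il}=0$. $V_{\mu\mu}=\partial^2V/\partial\mu^2$ lies in $\ell^{-6}S^2(U)$. *)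

(* Defs.v *)
From HB Require Import structures.
From mathcomp Require Import all_boot all_order all_algebra.
From mathcomp Require Import boolp classical_sets functions reals.
From mathcomp Require Import lra ring.

Set Implicit Arguments.
Unset Strict Implicit.
Unset Printing Implicit Defensive.

Import Order.TTheory GRing.Theory Num.Theory.
Local Open Scope classical_set_scope.
Local Open Scope ring_scope.

Definition GL3 (R : realType) := {A : 'M[R]_3 | A \in unitmx}.

Definition gl_inv (R : realType) (A : GL3 R) : GL3 R :=
  Sub (invmx (val A)) (etrans (unitmx_inv (val A)) (valP A)).

(* [ell A] is the scalar factor of A under GL(3) = R^x * SL(3): the unique t
   such that A = t B with det B = 1. *)
Definition ell (R : realType) (A : GL3 R) : R :=
  xget 0 [set t : R | exists2 B : 'M[R]_3, \det B = 1 & val A = t *: B].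

Definition ell_char (R : realType) (p : int) (A : GL3 R) : R := ell A ^ p.

Lemma ell_det (R : realType) (A : GL3 R) : ell A ^+ 3 = \det (val A).
Proof.
have dA0 : \det (val A) != 0 by have := valP A; rewrite unitmxE unitfE.
set c := \det (val A) in dA0 *.
have [t _ rt] : exists2 t : R, t \in `[- (1 + `|c|), 1 + `|c|]
    & root ('X^3 - c%:P) t.
  apply: poly_ivt; first by have := normr_ge0 c; lra.
  have := ler_norm c; have := ler_norm (- c); rewrite normrN => h1 h2.
  rewrite !hornerE.
  by apply/andP; split; nra.
have t3 : t ^+ 3 = c.
  by apply/eqP; move: rt; rewrite rootE !hornerE subr_eq0.
have t0 : t != 0 by apply: contra_neq dA0 => t0; rewrite -t3 t0 expr0n.
rewrite /ell; case: xgetP => [u _ [B dB AE]|/(_ t)[]].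
  by rewrite /c AE detZ dB mulr1.
exists (t^-1 *: val A); last by rewrite scalerA divff// scale1r.
by rewrite detZ -/c -t3 -exprMn mulVf// expr1n.
Qed.

Section Submodules.
Variable R : realType.

Definition symmx : {pred 'M[R]_3} := [pred V | V^T == V].

Lemma symmxP (V : 'M[R]_3) : reflect (V^T = V) (V \in symmx).
Proof. exact: eqP. Qed.

Fact symmx_closed : submod_closed symmx.
Proof.
split=> [|a U V]; first by apply/symmxP; rewrite trmx0.
by move=> /symmxP hU /symmxP hV; apply/symmxP; rewrite linearP/= hU hV.
Qed.
HB.instance Definition _ :=
  GRing.isSubmodClosed.Build R 'M[R]_3 symmx symmx_closed.

(* A first jet is T with [T k i j] = V_{ij,k}. *)
Definition dV_pred : {pred {ffun 'I_3 -> 'M[R]_3}} :=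
  [pred T : {ffun 'I_3 -> 'M[R]_3} |
    [forall k, T k \in symmx] && [forall j, \sum_i T i i j == 0]].

Lemma dVP (T : {ffun 'I_3 -> 'M[R]_3}) :
  reflect ((forall k, T k \in symmx) /\ forall j, \sum_i T i i j = 0)
          (T \in dV_pred).
Proof.
apply: (iffP andP) => -[h1 h2]; split.
- exact/forallP.
- by move=> j; apply/eqP; have /forallP := h2.
- exact/forallP.
- by apply/forallP => j; apply/eqP.
Qed.

Fact dV_closed : submod_closed dV_pred.
Proof.
split=> [|a S T].
  apply/dVP; split=> j; first by rewrite ffunE rpred0.
  by rewrite big1// => i _; rewrite ffunE mxE.
move=> /dVP[s1 s2] /dVP[t1 t2]; apply/dVP; split=> j.
  by rewrite !ffunE rpredD ?rpredZ.
under eq_bigr do rewrite !ffunE !mxE.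
by rewrite big_split/= -mulr_sumr s2 t2 mulr0 addr0.
Qed.
HB.instance Definition _ :=
  GRing.isSubmodClosed.Build R {ffun 'I_3 -> 'M[R]_3} dV_pred dV_closed.

(* A second jet is T with [T (k, l) i j] = V_{ij,kl}. *)
Definition d2V_pred : {pred {ffun 'I_3 * 'I_3 -> 'M[R]_3}} :=
  [pred T : {ffun 'I_3 * 'I_3 -> 'M[R]_3} |
    [&& [forall k, forall l, T (k, l) \in symmx],
        [forall k, forall l, T (k, l) == T (l, k)] &
        [forall j, forall l, \sum_i T (i, l) i j == 0]]].

Lemma d2VP (T : {ffun 'I_3 * 'I_3 -> 'M[R]_3}) :
  reflect [/\ forall k l, T (k, l) \in symmx,
              forall k l, T (k, l) = T (l, k) &
              forall j l, \sum_i T (i, l) i j = 0] (T \in d2V_pred).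
Proof.
apply: (iffP and3P) => -[h1 h2 h3]; split.
- by move=> k l; have /forallP/(_ k)/forallP := h1.
- by move=> k l; apply/eqP; have /forallP/(_ k)/forallP := h2.
- by move=> k l; apply/eqP; have /forallP/(_ k)/forallP := h3.
- by apply/forallP => k; apply/forallP.
- by apply/forallP => k; apply/forallP => l; apply/eqP.
- by apply/forallP => k; apply/forallP => l; apply/eqP.
Qed.

Fact d2V_closed : submod_closed d2V_pred.
Proof.
split=> [|a S T].
  apply/d2VP; split=> k l; rewrite ?ffunE ?rpred0//.
  by rewrite big1// => i _; rewrite ffunE mxE.
move=> /d2VP[s1 s2 s3] /d2VP[t1 t2 t3]; apply/d2VP; split=> k l.
- by rewrite !ffunE rpredD ?rpredZ.
- by rewrite !ffunE s2 t2.
- under eq_bigr do rewrite !ffunE !mxE.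
  by rewrite big_split/= -mulr_sumr s3 t3 mulr0 addr0.
Qed.
HB.instance Definition _ :=
  GRing.isSubmodClosed.Build R {ffun 'I_3 * 'I_3 -> 'M[R]_3} d2V_pred d2V_closed.

End Submodules.

(* S^2(U) *)
Definition S2U (R : realType) := {V : 'M[R]_3 | V \in @symmx R}.
(* l^{-4} Gamma_{2,1} : the divergence-free first derivatives *)
Definition dV (R : realType) :=
  {T : {ffun 'I_3 -> 'M[R]_3} | T \in @dV_pred R}.
(* second derivatives: symmetric in ij and in kl, with \sum_i V_{ij,il} = 0 *)
Definition d2V (R : realType) :=
  {T : {ffun 'I_3 * 'I_3 -> 'M[R]_3} | T \in @d2V_pred R}.

HB.instance Definition _ (R : realType) := SubChoice.on (S2U R).
HB.instance Definition _ (R : realType) :=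
  [SubChoice_isSubLmodule of S2U R by <:].
HB.instance Definition _ (R : realType) := SubChoice.on (dV R).
HB.instance Definition _ (R : realType) :=
  [SubChoice_isSubLmodule of dV R by <:].
HB.instance Definition _ (R : realType) := SubChoice.on (d2V R).
HB.instance Definition _ (R : realType) :=
  [SubChoice_isSubLmodule of d2V R by <:].

Section Actions.
Variable R : realType.
Implicit Type A : GL3 R.

(* V |-> A^{-t} V A^{-1} *)
Definition act_mx A (V : 'M[R]_3) : 'M[R]_3 :=
  (invmx (val A))^T *m V *m invmx (val A).

Fact act_mx_sym A V : V \in @symmx R -> act_mx A V \in @symmx R.
Proof.
by move=> /symmxP h; apply/symmxP; rewrite /act_mx !trmx_mul trmxK h mulmxA.
Qed.

Fact act_mx_contract A (F : 'I_3 -> 'M[R]_3) j :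
  (forall j, \sum_i F i i j = 0) ->
  \sum_k (\sum_m val A k m *: act_mx A (F m)) k j = 0.
Proof.
move=> F0; under eq_bigr do rewrite summxE.
rewrite exchange_big/=.
have E m : \sum_k (val A k m *: act_mx A (F m)) k j =
    (F m *m invmx (val A)) m j.
  rewrite -[in RHS](mul1mx (F m)) -(trmx1 R 3) -(mulVmx (valP A)) trmx_mul.
  rewrite -!mulmxA [RHS]mxE; apply: eq_bigr => k _.
  by rewrite [LHS]mxE /act_mx -mulmxA; congr (_ * _); rewrite mxE.
under eq_bigr do rewrite E mxE.
rewrite exchange_big/= big1// => n _.
by rewrite -mulr_suml F0 mul0r.
Qed.

Definition act_S2U A (V : S2U R) : S2U R :=
  Sub (act_mx A (val V)) (act_mx_sym A (valP V)).

(* d/dnu transforms by det(A)^{-1} A, since nu does by det(A) A^{-t} *)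
Definition act_ffun1 A (T : {ffun 'I_3 -> 'M[R]_3}) : {ffun 'I_3 -> 'M[R]_3} :=
  [ffun k => (\det (val A))^-1 *: \sum_m val A k m *: act_mx A (T m)].

Fact act_dV_subproof A (T : dV R) : act_ffun1 A (val T) \in @dV_pred R.
Proof.
have /dVP[h1 h2] := valP T.
apply/dVP; split=> j.
  rewrite ffunE rpredZ// rpred_sum// => m _.
  by rewrite rpredZ// act_mx_sym.
under eq_bigr do rewrite ffunE mxE.
by rewrite -mulr_sumr act_mx_contract ?mulr0.
Qed.

Definition act_dV A (T : dV R) : dV R := Sub (act_ffun1 A (val T)) (act_dV_subproof A T).

Definition act_ffun2 A (T : {ffun 'I_3 * 'I_3 -> 'M[R]_3}) :
    {ffun 'I_3 * 'I_3 -> 'M[R]_3} :=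
  [ffun kl => (\det (val A)) ^- 2 *:
     \sum_m \sum_n (val A kl.1 m * val A kl.2 n) *: act_mx A (T (m, n))].

Fact act_d2V_subproof A (T : d2V R) : act_ffun2 A (val T) \in @d2V_pred R.
Proof.
have /d2VP[h1 h2 h3] := valP T.
apply/d2VP; split=> k l.
- rewrite ffunE rpredZ// rpred_sum// => m _; rewrite rpred_sum// => n _.
  by rewrite rpredZ// act_mx_sym.
- rewrite !ffunE/= exchange_big/=; congr (_ *: _).
  apply: eq_bigr => m _; apply: eq_bigr => n _.
  by rewrite mulrC h2.
- under eq_bigr do rewrite ffunE mxE/=.
  rewrite -mulr_sumr.
  pose G m := \sum_n val A l n *: val T (m, n).
  have E m : \sum_n act_mx A (val A l n *: val T (m, n)) = act_mx A (G m).
    by rewrite /act_mx /G mulmx_sumr mulmx_suml.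
  transitivity ((\det (val A)) ^- 2 *
      \sum_i (\sum_m val A i m *: act_mx A (G m)) i k).
    congr (_ * _); apply: eq_bigr => i _; congr (fun_of_matrix _ i k).
    apply: eq_bigr => m _; rewrite -E scaler_sumr; apply: eq_bigr => n _.
    by rewrite -scalerA /act_mx -scalemxAr -scalemxAl.
  rewrite act_mx_contract ?mulr0// => j.
  under eq_bigr do rewrite summxE.
  rewrite exchange_big/= big1// => n _.
  under eq_bigr do rewrite mxE.
  by rewrite -mulr_sumr h3 mulr0.
Qed.

Definition act_d2V A (T : d2V R) : d2V R :=
  Sub (act_ffun2 A (val T)) (act_d2V_subproof A T).

(* l^{-6} S^2(U), where d^2V/dmu^2 lives: d/dmu transforms by det(A)^{-1} *)
Definition act_Vmumu A (W : S2U R) : S2U R :=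
  (\det (val A)) ^- 2 *: act_S2U A W.

Definition Ldom := (S2U R * d2V R * S2U R)%type.

Definition act_Ldom A (x : Ldom) : Ldom :=
  (act_S2U A x.1.1, act_d2V A x.1.2, act_Vmumu A x.2).

End Actions.

Section Operators.
Variable R : realType.

Definition L_mx (V : 'M[R]_3) (V2 : {ffun 'I_3 * 'I_3 -> 'M[R]_3})
    (Vmumu : 'M[R]_3) : 'M[R]_3 :=
  \matrix_(i, j) (Vmumu i j + \sum_k \sum_l V k l * V2 (k, l) i j).

Fact L_subproof (x : Ldom R) :
  L_mx (val x.1.1) (val x.1.2) (val x.2) \in @symmx R.
Proof.
have /d2VP[h _ _] := valP x.1.2.
have /symmxP hW := valP x.2.
apply/symmxP/matrixP => i j; rewrite !mxE -{1}hW mxE; congr (_ + _).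
apply: eq_bigr => k _; apply: eq_bigr => l _.
by have /symmxP hT := h k l; rewrite -{1}hT mxE.
Qed.

Definition L (x : Ldom R) : S2U R :=
  Sub (L_mx (val x.1.1) (val x.1.2) (val x.2)) (L_subproof x).

Definition Q_mx (T : {ffun 'I_3 -> 'M[R]_3}) : 'M[R]_3 :=
  \matrix_(i, j) - \sum_a \sum_b T b i a * T a j b.

Fact Q_subproof (T : dV R) : Q_mx (val T) \in @symmx R.
Proof.
apply/symmxP/matrixP => i j; rewrite !mxE; congr (- _).
rewrite exchange_big/=; apply: eq_bigr => a _; apply: eq_bigr => b _.
by rewrite mulrC.
Qed.

Definition Q (T : dV R) : S2U R := Sub (Q_mx (val T)) (Q_subproof T).

End Operators.

Section MapModules.
Variables (R : realType) (M N : lmodType R).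
Variables (actM : GL3 R -> M -> M) (actN : GL3 R -> N -> N).

Definition act_map (A : GL3 R) (F : M -> N) : M -> N :=
  fun x => actN A (F (actM (gl_inv A) x)).

Definition line (F : M -> N) : set (M -> N) := [set c *: F | c in [set: R]].

(* The line spanned by F is GL(3)-stable and isomorphic, as a GL(3)-module, to
   the one-dimensional module l^p, i.e. R with A acting by [ell_char p A];
   in particular F is nonzero. *)
Definition spans_ell (p : int) (F : M -> N) : Prop :=
  (forall A G, line F G -> line F (act_map A G)) /\
  exists phi : {linear R^o -> (M -> N)},
    [/\ injective phi, range phi = line F &
        forall A (x : R), phi (ell_char p A * x) = act_map A (phi x)].

Definition quadratic_map (F : M -> N) : Prop :=
  exists B : {bilinear M -> M -> N}, forall x, F x = B x x.

End MapModules.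

(* Main.v *)
Require Import Defs.
From HB Require Import structures.
From mathcomp Require Import all_boot all_order perm all_algebra.
From mathcomp Require Import boolp classical_sets functions reals.
From mathcomp Require Import ring lra.
Import GRing.Theory Num.Theory.
Local Open Scope ring_scope.

Set Implicit Arguments.
Unset Strict Implicit.
Unset Printing Implicit Defensive.

(** Both operators are built from V and its derivatives by contracting an index
in U with an index in U^*, so A acts on them only through the factor
[\det A ^+ 2] left by the two derivatives; as [ell A ^+ 3 = \det A], this is
the character l^6 ([Q_equivariant], [L_equivariant]).

Uniqueness is a highest weight argument.  Let F be an equivariant quadratic map
on Gamma_{2,1}; its polarization is an equivariant bilinear map P, and F is
recovered from it as half of P T T.  Inside Gamma_{2,1} the rank one tensors
w.w (x) eta, with w in U, eta in U^* and eta(w) = 0, form the cone over the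
orbit of the highest weight vector Thi = e_0.e_0 (x) e_1^*.  The stabilizer of
the line of Thi moves the lowest weight vector Tlo = e_1.e_1 (x) e_0^* to every
rank one tensor with w_1 and eta_0 nonzero ([adapted_frame]), and these still
span Gamma_{2,1} ([dV_span_generic]).  Hence P is determined by the single
value P Thi Tlo: if it vanishes, then so do P Thi, then P Tlo by exchanging e_0
and e_1, and then P ([bilinear_eq0]).  That value has torus weight e_0 + e_1, so
it is a multiple of the symmetric matrix unit at (0, 1) ([weight_support]).  For
Q the multiple is -1 ([polar_Q01]), so subtracting a suitable multiple of Q from
F gives an equivariant map whose polarization is zero. *)

(** * Lines of maps on which GL(3) acts by l^6 *)

Lemma ell_char6 (R : realType) (A : GL3 R) :
  ell_char 6 A = \det (val A) ^+ 2.
Proof. by rewrite -ell_det -exprM. Qed.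

Section CharacterLines.
Variables (R : realType) (M N : lmodType R).
Variables (actM : GL3 R -> M -> M) (actN : GL3 R -> N -> N).

Lemma spans_ell6I (F : M -> N) :
  (forall A c y, actN A (c *: y) = c *: actN A y) ->
  F <> 0 ->
  (forall A, act_map actM actN A F = \det (val A) ^+ 2 *: F) ->
  spans_ell actM actN 6 F.
Proof.
move=> actNZ F0 FE.
have actcF A c : act_map actM actN A (c *: F) = (c * \det (val A) ^+ 2) *: F.
  rewrite -scalerA -FE; apply/funext => x.
  by rewrite /act_map/= actNZ.
split=> [A _ [c _ <-]|].
  by rewrite actcF; exists (c * \det (val A) ^+ 2).
pose phi (x : R^o) : M -> N := x *: F.
have phiL : linear phi by move=> a x y; rewrite /phi scalerDl -scalerA.
pose phiH := GRing.isLinear.Build R R^o (M -> N) *:%R phi phiL.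
pose phiM : {linear R^o -> (M -> N)} := HB.pack phi phiH.
exists phiM; split=> [x y /eqP||A x].
- rewrite -subr_eq0 /= /phi -scalerBl scaler_eq0 subr_eq0.
  by case/orP=> /eqP.
- by [].
- by rewrite /= /phi actcF ell_char6 mulrC.
Qed.

(** The isomorphism from l^6 rules out F = 0, since a zero line cannot be the
injective image of R; and F itself is some [phi x], so the character can be read
off on F without a scalar left undetermined. *)
Lemma spans_ell6E (F : M -> N) : spans_ell actM actN 6 F ->
  F <> 0 /\ forall A, act_map actM actN A F = \det (val A) ^+ 2 *: F.
Proof.
move=> [_ [phi [inj_phi im_phi act_phi]]].
split=> [F0|A].
  have : range phi (phi 1) by exists 1.
  rewrite im_phi F0 => -[c _]; rewrite scaler0 -(linear0 phi) => /inj_phi/eqP.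
  by rewrite eq_sym oner_eq0.
have : range phi F by rewrite im_phi; exists 1 => //; rewrite scale1r.
by case=> x _ <-; rewrite -act_phi ell_char6 -linearZ.
Qed.

End CharacterLines.

(** * Equivariance of L and Q *)

Section Equivariance.
Variable R : realType.
Implicit Types (A : GL3 R) (V : 'M[R]_3).

Lemma act_mx_linear A : linear (act_mx A).
Proof.
move=> a U V.
by rewrite /act_mx mulmxDr mulmxDl -scalemxAr -scalemxAl.
Qed.

Lemma act_S2U_linear A : linear (@act_S2U R A).
Proof. by move=> a U V; apply/val_inj; rewrite /= act_mx_linear. Qed.

Lemma act_S2UZ A c (V : S2U R) : act_S2U A (c *: V) = c *: act_S2U A V.
Proof. exact: (scalable_linear (act_S2U_linear A)). Qed.

Lemma act_mx_gl_inv A V : act_mx (gl_inv A) V = (val A)^T *m V *m val A.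
Proof. by rewrite /act_mx /= invmxK. Qed.

Lemma act_mxK A : cancel (act_mx (gl_inv A)) (act_mx A).
Proof.
move=> V; rewrite act_mx_gl_inv /act_mx !mulmxA -trmx_mul mulmxV ?(valP A)//.
by rewrite trmx1 mul1mx -mulmxA mulmxV ?(valP A)// mulmx1.
Qed.

Lemma act_mxVK A : cancel (act_mx A) (act_mx (gl_inv A)).
Proof.
move=> V; rewrite act_mx_gl_inv /act_mx !mulmxA -trmx_mul mulVmx ?(valP A)//.
by rewrite trmx1 mul1mx -mulmxA mulVmx ?(valP A)// mulmx1.
Qed.

Lemma det_neq0 A : \det (val A) != 0.
Proof. by have := valP A; rewrite unitmxE unitfE. Qed.

Lemma act_ffun1_gl_inv A (T : {ffun 'I_3 -> 'M[R]_3}) k :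
  act_ffun1 (gl_inv A) T k =
  \det (val A) *:
    \sum_m invmx (val A) k m *: ((val A)^T *m T m *m val A).
Proof.
rewrite ffunE /= det_inv invrK; congr (_ *: _).
by apply: eq_bigr => m _; rewrite act_mx_gl_inv.
Qed.

Lemma act_ffun2_gl_inv A (T : {ffun 'I_3 * 'I_3 -> 'M[R]_3}) k l :
  act_ffun2 (gl_inv A) T (k, l) =
  \det (val A) ^+ 2 *:
    \sum_m \sum_n (invmx (val A) k m * invmx (val A) l n) *:
      ((val A)^T *m T (m, n) *m val A).
Proof.
rewrite ffunE /= det_inv exprVn invrK; congr (_ *: _).
apply: eq_bigr => m _; apply: eq_bigr => n _.
by rewrite act_mx_gl_inv.
Qed.

Lemma congruence_mxE A V i j :
  ((val A)^T *m V *m val A) i j =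
  \sum_p \sum_q val A p i * val A q j * V p q.
Proof.
rewrite mxE exchange_big /=; apply: eq_bigr => q _.
by rewrite mxE mulr_suml; apply: eq_bigr => p _; rewrite mxE; ring.
Qed.

(** For fixed i the entries V_{ia,b} form an endomorphism, with one index in U
and one in U^*, so that the double contraction in Q becomes a trace and
conjugation invariance of the trace does the work. *)
Definition slice (T : {ffun 'I_3 -> 'M[R]_3}) i : 'M[R]_3 :=
  \matrix_(b, a) T b i a.

Lemma Q_mxE T i j : Q_mx T i j = - \tr (slice T i *m slice T j).
Proof.
rewrite mxE exchange_big /mxtrace; congr (- _).
apply: eq_bigr => b _; rewrite mxE; apply: eq_bigr => a _.
by rewrite !mxE.
Qed.

Lemma slice_act A T i :
  slice (act_ffun1 (gl_inv A) T) i =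
  \det (val A) *:
    \sum_p val A p i *: (invmx (val A) *m slice T p *m val A).
Proof.
apply/matrixP => b a; rewrite mxE act_ffun1_gl_inv !mxE; congr (_ * _).
rewrite !summxE.
under eq_bigr => m _ do rewrite mxE congruence_mxE mulr_sumr.
rewrite exchange_big /=; apply: eq_bigr => p _.
rewrite 2!mxE mulr_sumr.
under [RHS]eq_bigr => q _ do rewrite mxE mulr_suml mulr_sumr.
rewrite [RHS]exchange_big /=; apply: eq_bigr => m _.
rewrite mulr_sumr; apply: eq_bigr => q _.
by rewrite mxE; ring.
Qed.

Lemma mxtrace_conj A U V :
  \tr ((invmx (val A) *m U *m val A) *m (invmx (val A) *m V *m val A)) =
  \tr (U *m V).
Proof.
rewrite -!mulmxA (mulmxA (val A)) mulmxV ?(valP A)// mul1mx.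
by rewrite mxtrace_mulC -!mulmxA mulmxV ?(valP A)// mulmx1.
Qed.

Lemma Q_equivariant A :
  act_map (@act_dV R) (@act_S2U R) A (@Q R) = \det (val A) ^+ 2 *: @Q R.
Proof.
apply/funext => T; apply/val_inj => /=; move: (val T) => {}T.
rewrite -[RHS](act_mxK A); congr act_mx.
rewrite act_mx_gl_inv -scalemxAr -scalemxAl.
apply/matrixP => i j; rewrite Q_mxE !slice_act [RHS]mxE congruence_mxE.
rewrite -scalemxAl -scalemxAr scalerA -expr2 linearZ /= -mulrN.
congr (_ * _); rewrite mulmx_suml linear_sum /= -sumrN.
apply: eq_bigr => p _; rewrite mulmx_sumr linear_sum /= -sumrN.
apply: eq_bigr => q _; rewrite -scalemxAl -scalemxAr scalerA linearZ /=.
by rewrite mxtrace_conj Q_mxE mulrN.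
Qed.

(** The counterpart of [slice] for L: the indices kl lie in the symmetric square
of U^*, which makes the contraction with V the trace pairing of S^2(U) with the
symmetric square of its dual. *)
Definition hessian (T : {ffun 'I_3 * 'I_3 -> 'M[R]_3}) i j : 'M[R]_3 :=
  \matrix_(k, l) T (k, l) i j.

Lemma L_mxE V T W i j :
  L_mx V T W i j = W i j + \tr (V *m (hessian T i j)^T).
Proof.
rewrite mxE; congr (_ + _); apply: eq_bigr => k _; rewrite mxE.
by apply: eq_bigr => l _; rewrite !mxE.
Qed.

Lemma hessian_act A T i j :
  hessian (act_ffun2 (gl_inv A) T) i j =
  \det (val A) ^+ 2 *:
    \sum_p \sum_q (val A p i * val A q j) *:
      (invmx (val A) *m hessian T p q *m (invmx (val A))^T).
Proof.
apply/matrixP => k l; rewrite mxE act_ffun2_gl_inv !mxE; congr (_ * _).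
rewrite !summxE.
under eq_bigr => m _.
  rewrite summxE.
  under eq_bigr => n _ do rewrite mxE congruence_mxE mulr_sumr.
  rewrite exchange_big /=.
  under eq_bigr => p _ do under eq_bigr => n _ do rewrite mulr_sumr.
  over.
rewrite exchange_big /=; apply: eq_bigr => p _; rewrite summxE.
under eq_bigr => m _ do rewrite exchange_big /=.
rewrite exchange_big /=; apply: eq_bigr => q _; rewrite 2!mxE mulr_sumr.
under [RHS]eq_bigr => n _ do rewrite mxE mulr_suml mulr_sumr.
rewrite [RHS]exchange_big /=; apply: eq_bigr => m _.
by apply: eq_bigr => n _; rewrite !mxE; ring.
Qed.

Lemma L_equivariant A :
  act_map (@act_Ldom R) (@act_S2U R) A (@L R) = \det (val A) ^+ 2 *: @L R.
Proof.
apply/funext => -[[V T] W]; apply/val_inj => /=.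
move: (val V) (val T) (val W) => {}V {}T {}W.
rewrite -[RHS](act_mxK A); congr act_mx.
rewrite [RHS]act_mx_gl_inv -scalemxAr -scalemxAl.
apply/matrixP => i j; rewrite L_mxE hessian_act [RHS]mxE congruence_mxE.
under [in RHS]eq_bigr => p _ do under eq_bigr => q _ do
  rewrite L_mxE mulrDr.
under [in RHS]eq_bigr => p _ do rewrite big_split.
rewrite big_split /= mulrDr -congruence_mxE; congr (_ + _).
  by rewrite mxE det_inv exprVn invrK act_mx_gl_inv.
rewrite linearZ /= -scalemxAr linearZ /=; congr (_ * _).
rewrite linear_sum /= mulmx_sumr linear_sum /=; apply: eq_bigr => p _.
rewrite linear_sum /= mulmx_sumr linear_sum /=; apply: eq_bigr => q _.
rewrite linearZ /= -scalemxAr linearZ /=; congr (_ * _).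
rewrite !trmx_mul trmxK act_mx_gl_inv !mulmxA -(mulmxA _ (val A)).
rewrite mulmxV ?(valP A)// mulmx1 mxtrace_mulC !mulmxA.
by rewrite -trmx_mul mulmxV ?(valP A)// trmx1 mul1mx.
Qed.

End Equivariance.

(** * Rank one tensors w.w (x) eta *)

Section RankOne.
Variable R : realType.
Implicit Types (A : GL3 R) (w v : 'cV[R]_3) (eta : 'cV[R]_3).

Definition rank_one_ffun w eta : {ffun 'I_3 -> 'M[R]_3} :=
  [ffun k => eta k 0 *: (w *m w^T)].

Lemma rank_one_ffunP w eta :
  eta^T *m w = 0 -> rank_one_ffun w eta \in @dV_pred R.
Proof.
move=> ew; apply/dVP; split=> [k|j].
  by apply/symmxP; rewrite ffunE linearZ /= trmx_mul trmxK.
transitivity ((eta^T *m w *m w^T) 0 j); last by rewrite ew mul0mx mxE.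
by rewrite -mulmxA mxE; apply: eq_bigr => i _; rewrite ffunE !mxE.
Qed.

(** The value off the incidence variety eta(w) = 0 is a junk one; totality keeps
proofs of incidence out of terms.  The lock stops unification from unfolding the
subtype projection when it compares two different rank one tensors. *)
Definition rank_one w eta : dV R :=
  locked (insubd 0 (rank_one_ffun w eta)).

Lemma val_rank_one w eta : eta^T *m w = 0 ->
  val (rank_one w eta) = rank_one_ffun w eta.
Proof.
by move=> ew; rewrite /rank_one -lock val_insubd rank_one_ffunP.
Qed.

Lemma rank_oneE w eta k i j : eta^T *m w = 0 ->
  val (rank_one w eta) k i j = eta k 0 * (w i 0 * w j 0).
Proof.
by move=> ew; rewrite val_rank_one// ffunE mxE mxE big_ord1 mxE.
Qed.

(** Writing the covector as A eta expresses the transformed tensor through A and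
its transpose alone, so that no inverse matrix has to be computed. *)
Lemma act_rank_one A w eta : eta^T *m ((val A)^T *m w) = 0 ->
  act_dV (gl_inv A) (rank_one w (val A *m eta)) =
  \det (val A) *: rank_one ((val A)^T *m w) eta.
Proof.
move=> ew; have ew' : (val A *m eta)^T *m w = 0.
  by rewrite trmx_mul -mulmxA.
apply/val_inj; rewrite /= !val_rank_one//; apply/ffunP => k.
rewrite act_ffun1_gl_inv !ffunE; congr (_ *: _).
rewrite trmx_mul trmxK.
transitivity (\sum_m (invmx (val A) k m * (val A *m eta) m 0) *:
  ((val A)^T *m w *m (w^T *m val A))).
  apply: eq_bigr => m _; rewrite ffunE -scalerA; congr (_ *: _).
  by rewrite -scalemxAr -scalemxAl !mulmxA.
rewrite -scaler_suml; congr (_ *: _).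
transitivity ((invmx (val A) *m (val A *m eta)) k 0); first by rewrite [RHS]mxE.
by rewrite mulmxA mulVmx ?(valP A)// mul1mx.
Qed.

Lemma rank_oneZ a b w eta : eta^T *m w = 0 ->
  rank_one (a *: w) (b *: eta) = (a ^+ 2 * b) *: rank_one w eta.
Proof.
move=> ew; have ew' : (b *: eta)^T *m (a *: w) = 0.
  by rewrite -scalemxAr linearZ /= -scalemxAl ew !scaler0.
apply/val_inj; rewrite /= !val_rank_one//; apply/ffunP => k.
by apply/matrixP => i j; rewrite !ffunE !mxE !big_ord1 !mxE; ring.
Qed.

Lemma rank_oneDr w eta zeta : eta^T *m w = 0 -> zeta^T *m w = 0 ->
  rank_one w (eta + zeta) = rank_one w eta + rank_one w zeta.
Proof.
move=> ew zw; have ezw : (eta + zeta)^T *m w = 0.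
  by rewrite linearD /= mulmxDl ew zw addr0.
apply/val_inj; rewrite /= !val_rank_one//; apply/ffunP => k.
by apply/matrixP => i j; rewrite !ffunE !mxE !big_ord1 !mxE; ring.
Qed.

Lemma rank_one_parallelogram w v eta : eta^T *m w = 0 -> eta^T *m v = 0 ->
  rank_one (w + v) eta + rank_one (w - v) eta =
  2 *: (rank_one w eta + rank_one v eta).
Proof.
move=> ew ev.
have ewDv : eta^T *m (w + v) = 0 by rewrite mulmxDr ew ev addr0.
have ewBv : eta^T *m (w - v) = 0 by rewrite mulmxBr ew ev subr0.
apply/val_inj; rewrite /= !val_rank_one//; apply/ffunP => k.
by apply/matrixP => i j; rewrite !ffunE !mxE !big_ord1 !mxE; ring.
Qed.

End RankOne.

Local Notation o0 := (@Ordinal 3 0 isT).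
Local Notation o1 := (@Ordinal 3 1 isT).
Local Notation o2 := (@Ordinal 3 2 isT).

Lemma ord3_ind (P : 'I_3 -> Prop) : P o0 -> P o1 -> P o2 -> forall i, P i.
Proof.
move=> P0 P1 P2 [[|[|[|//]]] lti].
- by rewrite (_ : Ordinal lti = o0)//; apply/val_inj.
- by rewrite (_ : Ordinal lti = o1)//; apply/val_inj.
- by rewrite (_ : Ordinal lti = o2)//; apply/val_inj.
Qed.

Lemma big_ord3 (V : nmodType) (F : 'I_3 -> V) : \sum_i F i = F o0 + F o1 + F o2.
Proof.
rewrite !big_ord_recl big_ord0 addr0 addrA.
by congr (F _ + F _ + F _); apply/val_inj.
Qed.

(** * Rank one tensors span the divergence-free jets *)

Section Span.
Variable R : realType.
Implicit Types (w v eta zeta : 'cV[R]_3).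

Definition vec3 (a b c : R) : 'cV[R]_3 := \col_i [:: a; b; c]`_i.

Lemma orthogonal3P w eta :
  eta^T *m w = 0 <->
  eta o0 0 * w o0 0 + eta o1 0 * w o1 0 + eta o2 0 * w o2 0 = 0.
Proof.
have E : (eta^T *m w) 0 0 =
    eta o0 0 * w o0 0 + eta o1 0 * w o1 0 + eta o2 0 * w o2 0.
  by rewrite mxE big_ord3 !mxE.
split=> [h|h]; first by rewrite -E h mxE.
by apply/matrixP => i j; rewrite !ord1 E h mxE.
Qed.

Definition basis_vec (i : 'I_3) : 'cV[R]_3 := delta_mx i 0.
Local Notation e := basis_vec.

(** A coordinate function whose lock keeps the rewriting of large linear
combinations from comparing their terms up to unfolding. *)
Definition entry (T : dV R) (k i j : 'I_3) : R := locked (val T k i j).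

Lemma entryE T k i j : entry T k i j = val T k i j.
Proof. by rewrite /entry -lock. Qed.

Lemma entry_inj S T :
  (forall k i j, entry S k i j = entry T k i j) -> S = T.
Proof.
move=> ST; apply/val_inj/ffunP => k; apply/matrixP => i j.
by have := ST k i j; rewrite !entryE.
Qed.

Lemma entryD S T k i j : entry (S + T) k i j = entry S k i j + entry T k i j.
Proof. by rewrite !entryE /= ffunE mxE. Qed.

Lemma entryZ a T k i j : entry (a *: T) k i j = a * entry T k i j.
Proof. by rewrite !entryE /= ffunE mxE. Qed.

Lemma entryN T k i j : entry (- T) k i j = - entry T k i j.
Proof. by rewrite -scaleN1r entryZ mulN1r. Qed.

(** The part of T attached to the U^* index k.  The product
e_i.e_j (x) e_k^* is a polarized square.  In weight e_i there is the traceless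
combination e_i.e_i (x) e_i^* - 2 e_i.e_k (x) e_k^*, equal to half of
(e_i + e_k)^2 (x) (e_i - e_k)^* + (e_i - e_k)^2 (x) (e_i + e_k)^* minus
e_k.e_k (x) e_i^*; the last term is what adds [entry T i i k] to the coefficient
of e_i.e_i (x) e_k^*, after the roles of i and k are exchanged. *)
Definition decomp_part (T : dV R) (i j k : 'I_3) : dV R :=
  (entry T k i i + entry T i i k) *: rank_one (e i) (e k)
  + (entry T k j j + entry T j j k) *: rank_one (e j) (e k)
  + (2^-1 * entry T k i j) *: (rank_one (e i + e j) (e k)
                               - rank_one (e i - e j) (e k))
  - (2^-1 * entry T k i k) *: (rank_one (e i + e k) (e i - e k)
                               + rank_one (e i - e k) (e i + e k))
  - (2^-1 * entry T k j k) *: (rank_one (e j + e k) (e j - e k)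
                               + rank_one (e j - e k) (e j + e k)).

Lemma orth_e i j : i != j -> (e i)^T *m e j = 0.
Proof. by move=> ij; rewrite trmx_delta mul_delta_mx_0. Qed.

Lemma orth_eDB i j : (e i + e j)^T *m (e i - e j) = 0.
Proof.
rewrite mulmxBr raddfD /= !mulmxDl !trmx_delta !mul_delta_mx.
by rewrite !mul_delta_mx_cond (eq_sym j i) [_ + delta_mx 0 0]addrC subrr.
Qed.

Lemma orth_eBD i j : (e i - e j)^T *m (e i + e j) = 0.
Proof. by rewrite -[LHS]trmxK trmx_mul trmxK orth_eDB trmx0. Qed.

Lemma entry_decomp_part T i j k m p q : i != j -> i != k -> j != k ->
  entry (decomp_part T i j k) m p q =
  let d (i j : 'I_3) : R := (j == i)%:R in
  let r (w eta : 'I_3 -> R) : R := eta m * (w p * w q) in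
  (entry T k i i + entry T i i k) * r (d i) (d k)
  + (entry T k j j + entry T j j k) * r (d j) (d k)
  + (2^-1 * entry T k i j) * (r (fun x => d i x + d j x) (d k)
                         - r (fun x => d i x - d j x) (d k))
  - (2^-1 * entry T k i k) *
     (r (fun x => d i x + d k x) (fun x => d i x - d k x)
      + r (fun x => d i x - d k x) (fun x => d i x + d k x))
  - (2^-1 * entry T k j k) *
     (r (fun x => d j x + d k x) (fun x => d j x - d k x)
      + r (fun x => d j x - d k x) (fun x => d j x + d k x)).
Proof.
move=> ij ik jk.
have eR w eta a : eta^T *m w = 0 -> a = eta m 0 * (w p 0 * w q 0) ->
    entry (rank_one w eta) m p q = a.
  by move=> ew ->; rewrite entryE; apply: rank_oneE.
have ki : k != i by rewrite eq_sym.
have kj : k != j by rewrite eq_sym.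
have lc (a b c d x : R) (A B C C' D D' E E' : dV R) :
  entry (a *: A + b *: B + c *: (C - C') - d *: (D + D') - x *: (E + E')) m p q
  = a * entry A m p q + b * entry B m p q
    + c * (entry C m p q - entry C' m p q)
    - d * (entry D m p q + entry D' m p q)
    - x * (entry E m p q + entry E' m p q).
  by do ?rewrite ?entryN ?entryZ ?entryD.
rewrite lc; congr (_ * _ + _ * _ + _ * (_ - _) - _ * (_ + _) - _ * (_ + _)).
all: apply: eR; last by rewrite !mxE eqxx ?andbT.
- exact: orth_e.
- exact: orth_e.
- by rewrite mulmxDr !orth_e// addr0.
- by rewrite mulmxBr !orth_e// subr0.
- exact: orth_eBD.
- exact: orth_eDB.
- exact: orth_eBD.
- exact: orth_eDB.
Qed.

(** The entries with k different from i and j match term by term; the entries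
[entry T i i i] come out right because the divergence of T vanishes. *)
Lemma dV_decomp T :
  T = decomp_part T o0 o1 o2 + decomp_part T o1 o2 o0 + decomp_part T o2 o0 o1.
Proof.
have [/= Tsym Ttr] := dVP _ (valP T).
have Ts k i j : entry T k i j = entry T k j i.
  by have /symmxP/matrixP/(_ j i) := Tsym k; rewrite mxE !entryE.
have Tt j : entry T o0 o0 j + entry T o1 o1 j + entry T o2 o2 j = 0.
  by rewrite -[RHS](Ttr j) big_ord3 !entryE.
apply: entry_inj => m p q.
have pE i j k ij ik jk := @entry_decomp_part T i j k m p q ij ik jk.
rewrite 2!entryD.
apply: etrans (esym (congr2 +%R (congr2 +%R (pE o0 o1 o2 _ _ _)
  (pE o1 o2 o0 _ _ _)) (pE o2 o0 o1 _ _ _))) => //.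
have := Tt o0; have := Tt o1; have := Tt o2.
have := Ts o0 o0 o1; have := Ts o0 o0 o2; have := Ts o0 o1 o2.
have := Ts o1 o0 o1; have := Ts o1 o0 o2; have := Ts o1 o1 o2.
have := Ts o2 o0 o1; have := Ts o2 o0 o2; have := Ts o2 o1 o2.
cbv zeta beta; clear pE; move: (entry T) m p q => t.
by do 3![elim/ord3_ind]; rewrite /=; lra.
Qed.

Variable K : dV R -> Prop.
Hypothesis K0 : K 0.
Hypothesis KL : forall a S T, K S -> K T -> K (a *: S + T).

Let KD S T : K S -> K T -> K (S + T).
Proof. by move=> KS KT; rewrite -(scale1r S); apply: KL. Qed.

Let KZ a S : K S -> K (a *: S).
Proof. by move=> KS; rewrite -(addr0 (_ *: _)); apply: KL. Qed.

Let KB S T : K S -> K T -> K (S - T).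
Proof. by move=> KS KT; rewrite -(scaleN1r T); apply/KD/KZ. Qed.

(** A subspace that contains the generic rank one tensors contains all of them.
For fixed w the covectors that vanish on w form a plane, spanned by those with
nonzero coordinate 0 as soon as w_1 is nonzero.  If w_1 = 0, a vector v with v_1
nonzero and annihilated by eta turns w into w + v and w - v, and the
parallelogram identity recovers w.w (x) eta.  Such a v exists unless eta is
proportional to e_1^*; then eta is first written as a difference of two other
covectors. *)
Lemma rank_one_of_generic :
  (forall w eta, eta^T *m w = 0 -> w o1 0 != 0 -> eta o0 0 != 0 ->
    K (rank_one w eta)) ->
  forall w eta, eta^T *m w = 0 -> K (rank_one w eta).
Proof.
move=> Kgen.
have subK w eta zeta : eta^T *m w = 0 -> zeta^T *m w = 0 ->
    K (rank_one w (eta + zeta)) -> K (rank_one w zeta) -> K (rank_one w eta).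
  by move=> ew zw Kez Kz; rewrite -(addrK (rank_one w zeta) (rank_one w eta))
    -rank_oneDr//; apply: KB.
have Kw w eta : eta^T *m w = 0 -> w o1 0 != 0 -> K (rank_one w eta).
  move=> ew w1; have [e0|] := eqVneq (eta o0 0) 0; last exact: Kgen.
  (* the covector with coordinates 0 and 2 equal to (1, 0) that kills w *)
  pose zeta := vec3 1 (- w o0 0 / w o1 0) 0.
  have zw : zeta^T *m w = 0 by apply/orthogonal3P; rewrite !mxE /=; field.
  have ezw : (eta + zeta)^T *m w = 0.
    by rewrite linearD /= mulmxDl ew zw addr0.
  apply: (subK _ _ zeta) => //; apply: Kgen => //.
    by rewrite !mxE /= e0 add0r oner_eq0.
  by rewrite !mxE /= oner_eq0.
have Kv w v eta : eta^T *m w = 0 -> eta^T *m v = 0 -> w o1 0 = 0 ->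
    v o1 0 != 0 -> K (rank_one w eta).
  move=> ew ev w1 v1.
  have -> : rank_one w eta = 2^-1 *: (rank_one (w + v) eta +
      rank_one (w - v) eta) - rank_one v eta.
    rewrite rank_one_parallelogram// scalerA mulVf ?scale1r ?addrK//.
    by rewrite pnatr_eq0.
  apply: KB; last exact: Kw.
  apply/KZ/KD; apply: Kw.
  - by rewrite mulmxDr ew ev addr0.
  - by rewrite mxE w1 add0r.
  - by rewrite mulmxBr ew ev subr0.
  - by rewrite !mxE w1 add0r oppr_eq0.
have Keta w eta : eta^T *m w = 0 -> w o1 0 = 0 ->
    (eta o0 0 != 0) || (eta o2 0 != 0) -> K (rank_one w eta).
  move=> ew w1 /orP[e0|e2].
    apply: (Kv _ (vec3 (- eta o1 0 / eta o0 0) 1 0)) => //.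
      by apply/orthogonal3P; rewrite !mxE /=; field.
    by rewrite mxE oner_eq0.
  apply: (Kv _ (vec3 0 1 (- eta o1 0 / eta o2 0))) => //.
    by apply/orthogonal3P; rewrite !mxE /=; field.
  by rewrite mxE oner_eq0.
move=> w eta ew; have [w1|] := eqVneq (w o1 0) 0; last exact: Kw.
have [|] := boolP ((eta o0 0 != 0) || (eta o2 0 != 0)); first exact: Keta.
rewrite negb_or !negbK => /andP[/eqP e0 /eqP e2].
(* kills w because w_1 = 0, and is proportional to e_1^* only for w = 0 *)
pose zeta := vec3 (w o2 0) 0 (- w o0 0).
have zw : zeta^T *m w = 0 by apply/orthogonal3P; rewrite !mxE /=; ring.
have ezw : (eta + zeta)^T *m w = 0.
  by rewrite linearD /= mulmxDl ew zw addr0.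
have [wn0|] := boolP ((w o2 0 != 0) || (- w o0 0 != 0)).
  apply: (subK _ _ zeta) => //; apply: Keta => //.
    by rewrite !mxE /= e0 e2 !add0r.
  by rewrite !mxE.
rewrite negb_or !negbK oppr_eq0 => /andP[/eqP w2 /eqP w0].
suff -> : rank_one w eta = 0 by [].
have -> : w = 0 *: w.
  by rewrite scale0r; apply/matrixP => i j; rewrite ord1 mxE; elim/ord3_ind: i.
by rewrite -[eta]scale1r rank_oneZ// expr0n mul0r scale0r.
Qed.

Lemma dV_span :
  (forall w eta, eta^T *m w = 0 -> K (rank_one w eta)) -> forall T, K T.
Proof.
move=> K1 T; rewrite [T]dV_decomp.
have Kp i j k : i != j -> i != k -> j != k -> K (decomp_part T i j k).
  move=> ij ik jk; rewrite /decomp_part.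
  have ki : k != i by rewrite eq_sym.
  have kj : k != j by rewrite eq_sym.
  apply: KB; first apply: KB; first (apply: KD; first apply: KD); apply: KZ.
  - by apply/K1/orth_e.
  - by apply/K1/orth_e.
  - apply: KB; apply: K1.
      by rewrite mulmxDr !orth_e// addr0.
    by rewrite mulmxBr !orth_e// subr0.
  - by apply: KD; apply: K1; [exact: orth_eBD | exact: orth_eDB].
  - by apply: KD; apply: K1; [exact: orth_eBD | exact: orth_eDB].
by apply: KD; first apply: KD; apply: Kp.
Qed.

Lemma dV_span_generic :
  (forall w eta, eta^T *m w = 0 -> w o1 0 != 0 -> eta o0 0 != 0 ->
    K (rank_one w eta)) ->
  forall T, K T.
Proof. by move=> Kgen; apply/dV_span/rank_one_of_generic. Qed.

End Span.

(** * An equivariant bilinear map is determined by one value *)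

Section Uniqueness.
Variable R : realType.
Local Notation e := (@basis_vec R).
Local Notation Thi := (rank_one (e o0) (e o1)).
Local Notation Tlo := (rank_one (e o1) (e o0)).

(** The stabilizer of the line of Thi acts transitively, up to scalars, on the
generic rank one tensors: the columns of A are eta, e_1 and the cross product
of e_0 with w, which vanishes on w. *)
Lemma adapted_frame (w eta : 'cV[R]_3) : eta^T *m w = 0 ->
  w o1 0 != 0 -> eta o0 0 != 0 ->
  exists A : GL3 R, [/\ val A *m e o0 = eta, val A *m e o1 = e o1,
    (val A)^T *m e o0 = eta o0 0 *: e o0 & (val A)^T *m w = w o1 0 *: e o1].
Proof.
move=> /orthogonal3P ew w1 e0.
pose a := eta o0 0; pose b := eta o1 0; pose c := - w o2 0.
pose d := eta o2 0; pose f := w o1 0.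
pose M : 'M[R]_3 := \matrix_(i, j)
  (nth [::] [:: [:: a; 0; 0]; [:: b; 1; c]; [:: d; 0; f]] i)`_j.
pose N : 'M[R]_3 := \matrix_(i, j)
  (nth [::] [:: [:: a^-1; 0; 0];
                [:: (c * d / f - b) / a; 1; - c / f];
                [:: - d / (a * f); 0; f^-1]] i)`_j.
have MN : M *m N = 1%:M.
  apply/matrixP; do 2![elim/ord3_ind]; rewrite !mxE big_ord3 !mxE /=; field;
    by rewrite ?e0 ?w1.
exists (Sub M (mulmx1_unit MN).1).
split; apply/matrixP; elim/ord3_ind => j; rewrite ord1 /= mxE big_ord3 !mxE /=;
  rewrite /a /b /c /d /f; move: ew; lra.
Qed.

Section EquivariantBilinear.
Variable P : dV R -> dV R -> S2U R.
Hypothesis PL : forall S, linear (P^~ S).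
Hypothesis PR : forall T, linear (P T).
Hypothesis Pact : forall A T S,
  act_S2U A (P (act_dV (gl_inv A) T) (act_dV (gl_inv A) S)) =
  \det (val A) ^+ 2 *: P T S.

Let PZl a T S : P (a *: T) S = a *: P T S.
Proof. exact: (scalable_linear (PL S)). Qed.

Let PZr a T S : P T (a *: S) = a *: P T S.
Proof. exact: (scalable_linear (PR T)). Qed.

Let act0 A : act_S2U A 0 = 0 :> S2U R.
Proof. by have := act_S2UZ A 0 0; rewrite !scale0r. Qed.

Let P0 A T S : P (act_dV (gl_inv A) T) (act_dV (gl_inv A) S) = 0 -> P T S = 0.
Proof.
move=> P0; have /eqP := Pact A T S; rewrite P0 act0 eq_sym scaler_eq0.
by rewrite expf_eq0 /= (negPf (det_neq0 A)) => /eqP.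
Qed.

(** One torus element is enough: diag(1, 2, 3) scales the value by 1 * 2, and
its (i, j) entry by (i + 1)(j + 1), which is 2 only at (0, 1) and (1, 0). *)
Lemma weight_support (i j : 'I_3) :
  (i.+1 * j.+1 != 2)%N -> val (P Thi Tlo) i j = 0.
Proof.
pose D : 'M[R]_3 := diag_mx (\row_i i.+1%:R).
have Du : D \in unitmx.
  rewrite unitmxE unitfE det_diag prodf_seq_neq0.
  by apply/allP => x _; rewrite mxE pnatr_eq0.
pose A : GL3 R := Sub D Du.
have De (x : 'I_3) : D *m e x = x.+1%:R *: e x.
  apply/matrixP => y z; rewrite !ord1 mul_diag_mx !mxE andbT.
  by case: eqP => [->|_]; rewrite ?mulr0.
have T0D : act_dV (gl_inv A) Thi = (\det D * 2^-1) *: Thi.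
  rewrite -[X in act_dV _ X]/(rank_one (e o0) (e o1)).
  have -> : e o1 = val A *m (2^-1 *: e o1).
    by rewrite /= -scalemxAr De scalerA mulVf ?scale1r// pnatr_eq0.
  rewrite act_rank_one /= ?tr_diag_mx De ?scale1r.
    rewrite -scalemxAr De !scalerA mulVf ?scale1r ?pnatr_eq0//.
    rewrite -[in LHS](scale1r (e o0)) rank_oneZ ?orth_e//.
    by rewrite expr1n mul1r scalerA.
  by rewrite linearZ /= -scalemxAl orth_e// scaler0.
have S0D : act_dV (gl_inv A) Tlo = (\det D * 4) *: Tlo.
  have {1}-> : e o0 = val A *m e o0 by rewrite /= De scale1r.
  rewrite act_rank_one /= tr_diag_mx De.
    rewrite -[e o0 in LHS]scale1r rank_oneZ ?orth_e// mulr1 scalerA.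
    by rewrite -natrX.
  by rewrite -scalemxAr orth_e// scaler0.
move=> ij; have := Pact A Thi Tlo.
rewrite T0D S0D PZl PZr scalerA act_S2UZ => /(congr1 val).
rewrite /= => /(congr1 (act_mx (gl_inv A))).
rewrite !(scalable_linear (act_mx_linear _)) act_mxVK act_mx_gl_inv.
rewrite tr_diag_mx => /matrixP/(_ i j).
move: (sval (P Thi Tlo)) => X; rewrite mul_diag_mx mul_mx_diag !mxE => E.
have : \det D ^+ 2 * ((i.+1 * j.+1)%:R - 2%:R) * X i j = 0.
  rewrite -[RHS](subrr (\det D / 2 * (\det D * 4) * X i j)) {1}E natrM.
  by field.
move/eqP; rewrite 2!mulf_eq0 expf_eq0 /= subr_eq0 eqr_nat (negPf ij) orbF.
by rewrite (negPf (det_neq0 A)) => /eqP.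
Qed.

(** Equivariance under the stabilizer of the line of Thi spreads the hypothesis
from Tlo to all second arguments.  The first arguments that pair to zero with
everything then form a GL(3)-stable subspace containing Thi, hence containing
every rank one tensor. *)
Lemma bilinear_eq0 : P Thi Tlo = 0 -> forall T S, P T S = 0.
Proof.
move=> PTS0.
have PT0 : forall S, P Thi S = 0.
  apply: dV_span_generic => [|a S S' pS pS'|w eta ew w1 e0].
  - by have := PZr 0 Thi 0; rewrite !scale0r.
  - by rewrite PR pS pS' scaler0 addr0.
  have [A [Ae0 Ae1 Ate0 Atw]] := adapted_frame ew w1 e0.
  apply: (P0 (A := A)).
  rewrite -Ae1 -Ae0 !act_rank_one ?Ate0 ?Atw.
  - rewrite PZl PZr -[e o1 in X in P X _]scale1r -[e o0 in X in P _ X]scale1r.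
    by rewrite !rank_oneZ ?orth_e// PZl PZr PTS0 !scaler0.
  - by rewrite -scalemxAr orth_e// scaler0.
  - by rewrite -scalemxAr orth_e// scaler0.
have PS0 : forall S, P Tlo S = 0.
  pose s : 'M[R]_3 := tperm_mx o0 o1.
  pose A : GL3 R := Sub s (unitmx_perm _ _).
  have se k : s *m e k = e (tperm o0 o1 k).
    by rewrite /s -row_permE; apply/matrixP => x y; rewrite !mxE !ord1 !andbT;
       rewrite (can2_eq (tpermK _ _) (tpermK _ _)).
  have st : s^T = s by rewrite tr_tperm_mx.
  move=> S; apply: (P0 (A := A)).
  have -> : Tlo = rank_one (e o1) (val A *m e o1) by rewrite se tpermR.
  by rewrite act_rank_one /= st se tpermR ?orth_e// PZl PT0 scaler0.
move=> T S; move: T; apply: dV_span_generic => [|a T T' pT pT'|w eta ew w1 e0].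
- by have := PZl 0 0 S; rewrite !scale0r.
- by rewrite PL pT pT' scaler0 addr0.
have [A [Ae0 Ae1 Ate0 Atw]] := adapted_frame ew w1 e0.
apply: (P0 (A := A)); rewrite -Ae0 act_rank_one ?Atw.
  rewrite -[e o0]scale1r rank_oneZ ?orth_e//.
  by rewrite !PZl PS0 !scaler0.
by rewrite -scalemxAr orth_e// scaler0.
Qed.

End EquivariantBilinear.

(** * Polarization, and uniqueness of Q *)

Definition polar (F : dV R -> S2U R) T S : S2U R := F (T + S) - F T - F S.

Lemma polarE (B : {bilinear dV R -> dV R -> S2U R}) T S :
  B (T + S) (T + S) - B T T - B S S = B T S + B S T.
Proof.
rewrite linearDr !linearDl /=; apply/eqP; rewrite 2!subr_eq addrC.
by rewrite [B T T + _]addrC addrA [_ + _ + B S T]addrAC.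
Qed.

Lemma polar_linear_r F T : quadratic_map F -> linear (polar F T).
Proof.
move=> [B FB] a S S'; rewrite /polar !FB !polarE.
by rewrite linearPr linearPl /= scalerDr addrACA.
Qed.

Lemma polarC F T S : polar F T S = polar F S T.
Proof. by rewrite /polar [S + T]addrC addrAC. Qed.

Lemma polar_diag F T : quadratic_map F -> polar F T T = 2 *: F T.
Proof.
by move=> [B FB]; rewrite /polar !FB polarE scaler_nat mulr2n.
Qed.

Lemma act_dVD (A : GL3 R) T S : act_dV A (T + S) = act_dV A T + act_dV A S.
Proof.
apply/val_inj/ffunP => k; rewrite /= !ffunE -scalerDr -big_split /=.
congr (_ *: _); apply: eq_bigr => m _; rewrite ffunE -scalerDr.
by have := act_mx_linear A 1 (sval T m) (sval S m); rewrite !scale1r => ->.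
Qed.

Lemma polar_equivariant F A T S :
  act_map (@act_dV R) (@act_S2U R) A F = \det (val A) ^+ 2 *: F ->
  act_S2U A (polar F (act_dV (gl_inv A) T) (act_dV (gl_inv A) S)) =
  \det (val A) ^+ 2 *: polar F T S.
Proof.
move=> FA.
have FE X : act_S2U A (F (act_dV (gl_inv A) X)) = \det (val A) ^+ 2 *: F X.
  by have := congr1 (fun f => f X) FA.
rewrite /polar -act_dVD !(zmod_morphism_linear (act_S2U_linear A)).
by rewrite !FE !scalerBr.
Qed.

Lemma polar_Q01 : val (polar (@Q R) Thi Tlo) o0 o1 = -1.
Proof.
have eT k i j : entry Thi k i j = ((k == o1) && (i == o0) && (j == o0))%:R.
  by rewrite entryE rank_oneE ?orth_e// !mxE !andbT -!natrM !mulnb andbA.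
have eS k i j : entry Tlo k i j = ((k == o0) && (i == o1) && (j == o1))%:R.
  by rewrite entryE rank_oneE ?orth_e// !mxE !andbT -!natrM !mulnb andbA.
have QE (T : dV R) : val (Q T) o0 o1 =
    - \sum_a \sum_b entry T b o0 a * entry T a o1 b.
  rewrite mxE; congr (- _).
  by apply: eq_bigr => a _; apply: eq_bigr => b _; rewrite !entryE.
have polQ T S : val (polar (@Q R) T S) o0 o1 = - \sum_a \sum_b
    (entry T b o0 a * entry S a o1 b + entry S b o0 a * entry T a o1 b).
  transitivity (val (Q (T + S)) o0 o1 - val (Q T) o0 o1 - val (Q S) o0 o1).
    by rewrite /= !mxE.
  rewrite !QE -!opprD; congr (- _).
  rewrite -!sumrB; apply: eq_bigr => a _; rewrite -!sumrB.
  by apply: eq_bigr => b _; rewrite !entryD; ring.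
rewrite polQ; move: (entry Thi) (entry Tlo) eT eS => t s eT eS.
by rewrite !big_ord3 !eT !eS /=; ring.
Qed.

Lemma slice_linear i : linear (fun T : dV R => slice (val T) i).
Proof.
by move=> a S T; apply/matrixP => k j; rewrite /= !mxE !ffunE !mxE.
Qed.

(** The average over the exchange of T and S is what makes the values symmetric
matrices: the unsymmetrized contraction is transposed by that exchange. *)
Definition Q_bil_mx (T S : dV R) : 'M[R]_3 :=
  \matrix_(i, j) - (2^-1 * (\tr (slice (val T) i *m slice (val S) j)
                            + \tr (slice (val S) i *m slice (val T) j))).

Lemma Q_bil_mxC T S : Q_bil_mx T S = Q_bil_mx S T.
Proof. by apply/matrixP => i j; rewrite !mxE addrC. Qed.

Lemma Q_bil_sym T S : Q_bil_mx T S \in @symmx R.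
Proof.
apply/symmxP/matrixP => i j; rewrite !mxE addrC.
by rewrite mxtrace_mulC [X in _ + X]mxtrace_mulC.
Qed.

Definition Q_bil T S : S2U R := Sub (Q_bil_mx T S) (Q_bil_sym T S).

Lemma Q_bil_linear T : linear (Q_bil T).
Proof.
move=> a S S'; apply/val_inj/matrixP => i j; rewrite /= !mxE.
rewrite !slice_linear mulmxDl mulmxDr -scalemxAl -scalemxAr.
by rewrite !linearD /= !linearZ /=; ring.
Qed.

Lemma Q_quadratic : quadratic_map (@Q R).
Proof.
have Q_bilC T S : Q_bil T S = Q_bil S T by apply/val_inj/Q_bil_mxC.
have bil : bilinear_for *:%R *:%R Q_bil.
  split=> T; last exact: Q_bil_linear.
  by move=> a S S'; rewrite !(Q_bilC _ T) Q_bil_linear.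
pose BH :=
  bilinear_isBilinear.Build R (dV R) (dV R) (S2U R) *:%R *:%R Q_bil bil.
pose B : {bilinear dV R -> dV R -> S2U R} := HB.pack Q_bil BH.
by exists B => T; apply/val_inj/matrixP => i j; rewrite /= Q_mxE mxE; field.
Qed.

Lemma equivariant_quadratic_unique F :
  quadratic_map F ->
  (forall A, act_map (@act_dV R) (@act_S2U R) A F = \det (val A) ^+ 2 *: F) ->
  exists c : R, F = c *: @Q R.
Proof.
move=> quadF actF.
pose c := - val (polar F Thi Tlo) o0 o1; exists c.
pose P T S := polar F T S - c *: polar (@Q R) T S.
have PR T : linear (P T).
  move=> a S S'; rewrite /P (polar_linear_r T quadF).
  rewrite (polar_linear_r T Q_quadratic) [c *: (_ + _)]scalerDr.
  by rewrite opprD addrACA [in RHS]scalerBr !scalerA (mulrC a).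
have PL S : linear (P^~ S).
  by move=> a T T'; rewrite /P !(polarC _ _ S); apply: PR.
have Pact A T S :
    act_S2U A (P (act_dV (gl_inv A) T) (act_dV (gl_inv A) S)) =
    \det (val A) ^+ 2 *: P T S.
  rewrite /P (zmod_morphism_linear (act_S2U_linear A)) act_S2UZ.
  rewrite polar_equivariant// polar_equivariant; last exact: Q_equivariant.
  by rewrite [RHS]scalerBr !scalerA (mulrC c).
have P01 : val (P Thi Tlo) o0 o1 = 0.
  transitivity (val (polar F Thi Tlo) o0 o1 -
      c * val (polar (@Q R) Thi Tlo) o0 o1); first by rewrite /= !mxE.
  by rewrite polar_Q01 mulrN1 opprK addrN.
have P0 : P Thi Tlo = 0.
  apply/val_inj/matrixP; rewrite [val 0]/=.
  have /symmxP/matrixP/(_ o0 o1) := valP (P Thi Tlo).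
  rewrite mxE P01 => P10.
  do 2![elim/ord3_ind]; rewrite [RHS]mxE //;
    exact: (weight_support PL PR Pact).
apply/funext => T; apply/eqP; rewrite -subr_eq0.
have := bilinear_eq0 PL PR Pact P0 T T.
rewrite /P (polar_diag T quadF) (polar_diag T Q_quadratic).
rewrite scalerA mulrC -scalerA -scalerBr => /eqP.
by rewrite scaler_eq0 pnatr_eq0.
Qed.

End Uniqueness.

Theorem proposition3p8 (R : realType) :
  [/\ spans_ell (@act_Ldom R) (@act_S2U R) 6 (@L R),
      quadratic_map (@Q R),
      spans_ell (@act_dV R) (@act_S2U R) 6 (@Q R) &
      forall F : dV R -> S2U R,
        quadratic_map F ->
        spans_ell (@act_dV R) (@act_S2U R) 6 F ->
        exists c : R, c != 0 /\ F = c *: @Q R].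
Proof.
split.
- apply: spans_ell6I => [||A]; [exact: act_S2UZ | | exact: L_equivariant].
  have sym1 : 1%:M \in @symmx R by apply/symmxP; rewrite trmx1.
  (* at V = 0 only the term V_mumu of L survives *)
  pose x : Ldom R := (0, 0, Sub 1%:M sym1).
  move=> /(congr1 (fun f : Ldom R -> S2U R => val (f x) o0 o0)).
  rewrite /= !mxE big1 => [|k _]; last first.
    by rewrite big1 => // l _; rewrite !mxE mul0r.
  by rewrite addr0 => /eqP; rewrite oner_eq0.
- exact: Q_quadratic.
- apply: spans_ell6I => [||A]; [exact: act_S2UZ | | exact: Q_equivariant].
  move=> Q0; have /eqP := polar_Q01 R.
  by rewrite Q0 /polar /= !mxE !subr0 eq_sym oppr_eq0 oner_eq0.
- move=> F quadF /spans_ell6E[F0 actF].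
  have [c FE] := equivariant_quadratic_unique quadF actF.
  exists c; split=> //; apply: contra_not_neq F0 => c0.
  by rewrite FE c0 scale0r.
Qed.
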